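(* Let $d\ge1$ and $n\ge d+3$. Then any linear automorphism ${\bf A}$ of $L_{d,n}$ is a scalar multiple of a signed permutation induced by a vertex relabeling, i.e., ${\bf A}=c\,{\bf S}{\bf P}$ with $c\in\mathbb C\setminus\{0\}$, ${\bf S}$ diagonal with entries $\pm1$, and ${\bf P}$ a permutation matrix sending $e_{\{i,j\}}$ to $e_{\{\sigma(i),\sigma(j)\}}$ for some permutation $\sigma$ of $\{1,\dots,n\}$.
   Context: Let $N=\binom n2$ and index coordinates of $\mathbb C^N$ by edges $\{i,j\}$ of $K_n$. For a complex configuration ${\bf p}$ of $n$ points in $\mathbb C^d$, $m({\bf p})\in\mathbb C^N$ has coordinates $m_{ij}({\bf p})=\sum_{k=1}^d({\bf p}_i^k-{\bf p}_j^k)^2$ (no conjugation); $M_{d,n}$ is the image of $m$; $L_{d,n}=s^{-1}(M_{d,n})$ with $s$ the coordinatewise squaring map. A linear automorphism of $L_{d,n}$ is a non-singular $N\times N$ complex matrix mapping $L_{d,n}$ bijectively onto itself. *)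

(* Defs.v *)
From HB Require Import structures.
From mathcomp Require Import all_boot all_order all_algebra all_fingroup.
From mathcomp Require Import complex.
From mathcomp Require Import Rstruct.
From Stdlib Require Rdefinitions.
Set Implicit Arguments. Unset Strict Implicit. Unset Printing Implicit Defensive.
Import Order.TTheory GRing.Theory Num.Theory.
Local Open Scope ring_scope.

Notation CC := (complex Rdefinitions.R).

(* Edges {i,j} of K_n, represented by ordered pairs (i,j) with i < j. *)
Definition edge (n : nat) := {x : 'I_n * 'I_n | (nat_of_ord x.1 < nat_of_ord x.2)%N}.

(* N = #|edge n| = binomial n 2 ; coordinates of C^N are indexed by 'I_N via enum_val *)
Definition Nc (n : nat) : nat := #|{: edge n}|.

Definition ecoord n (k : 'I_(Nc n)) : edge n := enum_val k.

Definition eset n (e : edge n) : {set 'I_n} := [set (val e).1; (val e).2].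

(* m(p) : squared-distance map (no conjugation), p : n points in C^d *)
Definition mmap (d n : nat) (p : 'I_n -> 'I_d -> CC) : 'cV[CC]_(Nc n) :=
  \col_k \sum_(a < d) (p (val (ecoord k)).1 a - p (val (ecoord k)).2 a) ^+ 2.

Definition Mset (d n : nat) (y : 'cV[CC]_(Nc n)) : Prop :=
  exists p : 'I_n -> 'I_d -> CC, y = mmap p.

Definition sqmap n (x : 'cV[CC]_(Nc n)) : 'cV[CC]_(Nc n) := map_mx (fun z => z ^+ 2) x.

Definition Lset (d n : nat) (x : 'cV[CC]_(Nc n)) : Prop := Mset d (sqmap x).

Definition lin_aut (d n : nat) (A : 'M[CC]_(Nc n)) : Prop :=
  A \in unitmx /\
  (forall x, Lset d x -> Lset d (A *m x)) /\
  (forall y, Lset d y -> exists2 x, Lset d x & A *m x = y).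

Definition edge_perm_mx n (s : 'S_n) : 'M[CC]_(Nc n) :=
  \matrix_(k, l) (eset (ecoord k) == s @: eset (ecoord l))%:R.

Definition sign_diag n (S : 'M[CC]_(Nc n)) : Prop :=
  is_diag_mx S /\ forall k, S k k = 1 \/ S k k = -1.

(* Main.v *)
From mathcomp Require Import all_boot all_order all_algebra all_fingroup.
From mathcomp Require Import complex Rstruct zify ring mpoly.
Require Import Defs.
Set Implicit Arguments. Unset Strict Implicit. Unset Printing Implicit Defensive.
Import Order.TTheory GRing.Theory Num.Theory.
Local Open Scope ring_scope.

(**
L is stable under the coordinate sign flips, and M = M_d is the set of vectors whose Gram
matrix has rank at most d, that is, the d-fold sum of M_1, where M_1 spans C^N.

A polynomial of degree at most d vanishing on M is zero: the difference operators along
M_1 lower both the degree and d.  Splitting a polynomial h according to the parities of its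
exponents, h(x) = sum_s x^s q_s(x^2), it follows that every h of degree at most 2d+2
vanishing on L is even in each variable, since q_s has degree at most d for s nonempty.
Applied to h = P o A, with P a Gram minor on a set K of d+2 vertices, this says that P is
invariant under the reflection A s_e A^-1 : z |-> z - f(z) v conjugate to the flip s_e.  If
v has a nonzero entry on an edge e0 and f on an edge e1 <> e0, choose K containing e0 but
missing a vertex of e1 (possible as n >= d+3): moving z along e1 changes f(z) but not P, so
P is invariant under translation by v, hence, by the flip at e0, it does not depend on the
coordinate e0, which is absurd.  So A is monomial.

The matrix B of squared entries of A preserves M_d.  It preserves M_1 by descent: y is in
M_k iff the directions z with y + tz in M_(k+1) for all t span C^N.  A vector of M_1 with
fewer than n nonzero entries is a multiple of the indicator of a vertex star, so B permutes
the stars up to scalars, which gives the vertex relabeling; the scalars agree because two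
stars share an edge.
*)

(** * Degree of a function, measured by iterated differences *)

Section DifferenceDegree.
Variables (R : comNzRingType) (V : zmodType).
Implicit Types (f g : V -> R) (b y : V).

(** Encodes degree at most [k] by differences, since the vanishing argument on M_k only ever
    translates along M_1. *)
Fixpoint diff_deg (k : nat) (g : V -> R) : Prop :=
  if k is k'.+1 then forall b, diff_deg k' (fun y => g (y + b) - g y)
  else forall x y, g x = g y.

Lemma diff_deg_ext k f g : f =1 g -> diff_deg k f -> diff_deg k g.
Proof.
elim: k f g => [|k IH] f g efg /=; first by move=> fc x y; rewrite -!efg.
by move=> fd b; apply: IH (fd b) => y /=; rewrite !efg.
Qed.

Lemma diff_degW k g : diff_deg k g -> diff_deg k.+1 g.
Proof.
elim: k g => [|k IH] g; first by move=> gc b x y; rewrite (gc _ x) (gc (y + b) y) !subrr.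
by move=> gd b; apply: IH (gd b).
Qed.

Lemma diff_deg_le j k g : (j <= k)%N -> diff_deg j g -> diff_deg k g.
Proof.
by move/subnK <-; elim: (k - j)%N => [|i IH] // /IH; apply: diff_degW.
Qed.

Lemma diff_deg_cst k (c : R) : diff_deg k (fun=> c).
Proof. by apply: (@diff_deg_le 0). Qed.

Lemma diff_degD k f g :
  diff_deg k f -> diff_deg k g -> diff_deg k (fun y => f y + g y).
Proof.
elim: k f g => [|k IH] f g fd gd; first by move=> x y; rewrite (fd x y) (gd x y).
by move=> b; apply: diff_deg_ext (IH _ _ (fd b) (gd b)) => y /=; ring.
Qed.

Lemma diff_degZ k (c : R) g : diff_deg k g -> diff_deg k (fun y => c * g y).
Proof.
elim: k g => [|k IH] g gd; first by move=> x y; rewrite (gd x y).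
by move=> b; apply: diff_deg_ext (IH _ (gd b)) => y /=; ring.
Qed.

Lemma diff_deg_shift k b g : diff_deg k g -> diff_deg k (fun y => g (y + b)).
Proof.
case: k => [|k] gd; first by move=> x y; apply: gd.
apply: (@diff_deg_ext _ (fun y => g y + (g (y + b) - g y))) => [y|].
  by rewrite addrC subrK.
by apply: diff_degD => //; apply/diff_degW/gd.
Qed.

Lemma diff_degM j k f g :
  diff_deg j f -> diff_deg k g -> diff_deg (j + k) (fun y => f y * g y).
Proof.
elim: j k f g => [|j IHj] k f g.
  move=> fc gd; apply: diff_deg_ext (diff_degZ (f 0) gd) => y.
  by rewrite (fc y 0).
elim: k f g => [|k IHk] f g fd gd.
  rewrite addn0; apply: diff_deg_ext (diff_degZ (g 0) fd) => y.
  by rewrite (gd y 0) mulrC.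
move=> b /=.
(* Discrete Leibniz rule; the shift by [b] left on [g] does not affect its degree. *)
apply: (@diff_deg_ext _ (fun y => (f (y + b) - f y) * g (y + b)
                                  + f y * (g (y + b) - g y))).
  by move=> y; ring.
apply: diff_degD; first exact/IHj/diff_deg_shift/gd/fd.
by rewrite addnS -addSn; apply/IHk/gd/fd.
Qed.

Lemma diff_deg_sum (I : Type) (r : seq I) (P : pred I) k (F : I -> V -> R) :
  (forall i, P i -> diff_deg k (F i)) ->
  diff_deg k (fun y => \sum_(i <- r | P i) F i y).
Proof.
move=> Fd; elim: r => [|i r IH].
  by apply: diff_deg_ext (diff_deg_cst k 0) => y; rewrite big_nil.
have [Pi|nPi] := boolP (P i).
  by apply: diff_deg_ext (diff_degD (Fd i Pi) IH) => y; rewrite big_cons Pi.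
by apply: diff_deg_ext IH => y; rewrite big_cons (negPf nPi).
Qed.

Lemma diff_deg_exp j f : diff_deg 1 f -> diff_deg j (fun y => f y ^+ j).
Proof.
move=> fd; elim: j => [|j IH] //.
by rewrite -[j.+1]add1n; apply: diff_deg_ext (diff_degM fd IH) => y; rewrite exprS.
Qed.

Lemma diff_deg_prod (I : Type) (r : seq I) (e : I -> nat) (F : I -> V -> R) :
  (forall i, diff_deg 1 (F i)) ->
  diff_deg (\sum_(i <- r) e i) (fun y => \prod_(i <- r) F i y ^+ e i).
Proof.
move=> Fd; elim: r => [|i r IH].
  by apply: diff_deg_ext (diff_deg_cst _ 1) => y; rewrite big_nil.
rewrite big_cons.
by apply: diff_deg_ext (diff_degM (diff_deg_exp (e i) (Fd i)) IH) => y; rewrite big_cons.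
Qed.

End DifferenceDegree.

(** * Edges of K_n as two-element vertex sets *)

Section Edges.
Variable n : nat.
Implicit Types (k : 'I_(Nc n)) (i j : 'I_n).

Definition vert (k : 'I_(Nc n)) : {set 'I_n} := eset (ecoord k).

Lemma vertE k : vert k = [set (val (ecoord k)).1; (val (ecoord k)).2].
Proof. by []. Qed.

Lemma vert_neq k : (val (ecoord k)).1 != (val (ecoord k)).2.
Proof. by case: (ecoord k) => -[i j] /= lt_ij; rewrite -val_eqE /= neq_ltn lt_ij. Qed.

Lemma vert_inj : injective vert.
Proof.
move=> k l; rewrite !vertE => ekl; apply: enum_val_inj; apply: val_inj.
change (val (ecoord k) = val (ecoord l)).
have := valP (ecoord k); have := valP (ecoord l).
move: ekl; case: (val (ecoord k)) => a b; case: (val (ecoord l)) => c e /= ekl lt_ce lt_ab.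
have : a \in [set c; e] by rewrite -ekl !inE eqxx.
have : b \in [set c; e] by rewrite -ekl !inE eqxx orbT.
rewrite !inE => /orP[]/eqP eb /orP[]/eqP ea; subst => //; first by rewrite ltnn in lt_ab.
  by have := ltn_trans lt_ce lt_ab; rewrite ltnn.
by rewrite ltnn in lt_ab.
Qed.

Lemma vert_ex i j : i != j -> exists k, vert k = [set i; j].
Proof.
move=> neq_ij.
wlog lt_ij : i j neq_ij / (i < j)%N.
  move=> W; have := neq_ij; rewrite -val_eqE neq_ltn => /orP[] lt; first exact: W.
  by rewrite setUC; apply: W; rewrite // eq_sym.
pose e : edge n := Sub (i, j) lt_ij.
by exists (enum_rank e); rewrite vertE /ecoord enum_rankK.
Qed.

Lemma vert_pair k : exists i j, i != j /\ vert k = [set i; j].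
Proof. by exists (val (ecoord k)).1, (val (ecoord k)).2; split; first exact: vert_neq. Qed.

Lemma card_vert k : #|vert k| = 2.
Proof. by rewrite vertE cards2 vert_neq. Qed.

Lemma eq_set2 (T : finType) (a b c e : T) :
  ([set a; b] == [set c; e]) = (a == c) && (b == e) || (a == e) && (b == c).
Proof.
apply/idP/idP => [/eqP eq|/orP[]/andP[/eqP-> /eqP->] //]; last by rewrite setUC.
have : a \in [set c; e] by rewrite -eq !inE eqxx.
have : b \in [set c; e] by rewrite -eq !inE eqxx orbT.
have : c \in [set a; b] by rewrite eq !inE eqxx.
have : e \in [set a; b] by rewrite eq !inE eqxx orbT.
rewrite !inE (eq_sym e a) (eq_sym e b) (eq_sym c a) (eq_sym c b).
by case: (a == c); case: (a == e); case: (b == c); case: (b == e).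
Qed.

(* The entry of y on the edge {i, j}, extended by 0 to i = j. *)
Definition entry (y : 'cV[CC]_(Nc n)) i j : CC :=
  \sum_(k | vert k == [set i; j]) y k 0.

Lemma entryC y i j : entry y i j = entry y j i.
Proof. by rewrite /entry setUC. Qed.

Lemma entry_diag y i : entry y i i = 0.
Proof.
apply: big_pred0 => k; apply/negP => /eqP /(congr1 (fun A : {set _} => #|A|)).
by rewrite card_vert setUid cards1.
Qed.

Lemma entryE y i j k : vert k = [set i; j] -> entry y i j = y k 0.
Proof.
move=> ek; rewrite /entry -ek.
by rewrite (eq_bigl (pred1 k)) ?big_pred1_eq // => l; rewrite (inj_eq vert_inj).
Qed.

Lemma entryD y z i j : entry (y + z) i j = entry y i j + entry z i j.
Proof. by rewrite -big_split; apply: eq_bigr => k _; rewrite mxE. Qed.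

Lemma entryZ c y i j : entry (c *: y) i j = c * entry y i j.
Proof. by rewrite big_distrr; apply: eq_bigr => k _; rewrite mxE. Qed.

Lemma entry_mmap d (p : 'I_n -> 'I_d -> CC) i j :
  entry (mmap p) i j = \sum_a (p i a - p j a) ^+ 2.
Proof.
have [<-|neq_ij] := eqVneq i j.
  by rewrite entry_diag big1 // => a _; rewrite subrr expr0n.
have [k ek] := vert_ex neq_ij; rewrite (entryE _ ek) mxE.
move/eqP: ek; rewrite vertE eq_set2 => /orP[]/andP[/eqP-> /eqP->] //.
by apply: eq_bigr => a _; rewrite -opprB sqrrN.
Qed.

Lemma entry_inj y z : (forall i j, i != j -> entry y i j = entry z i j) -> y = z.
Proof.
move=> eyz; apply/colP => k; have [i [j [neq_ij ek]]] := vert_pair k.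
by rewrite -(entryE y ek) -(entryE z ek) eyz.
Qed.

End Edges.

(** * The sets M_k, and vanishing of low-degree functions on them *)

Section MeasurementSets.
Variable n : nat.
Implicit Types (y b : 'cV[CC]_(Nc n)) (A : {set 'I_n}).

Lemma Mset0 k : Mset k (0 : 'cV[CC]_(Nc n)).
Proof.
exists (fun _ _ => 0); apply/colP => l; rewrite !mxE big1 // => a _.
by rewrite subrr expr0n.
Qed.

Lemma MsetD_Mset1 k y b : Mset k y -> Mset 1 b -> Mset k.+1 (y + b).
Proof.
case=> p -> [q ->].
(* The collinear configuration [q] is appended to [p] as a last coordinate. *)
exists (fun i a => if unlift ord_max a is Some a' then p i a' else q i 0).
apply/colP => l; rewrite !mxE big_ord1 [RHS]big_ord_recr /= unlift_none; congr (_ + _).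
apply: eq_bigr => a _.
have -> : widen_ord (leqnSn k) a = lift ord_max a.
  by apply/val_inj; rewrite /= /bump leqNgt ltn_ord.
by rewrite liftK.
Qed.

Lemma MsetZ k c y : Mset k y -> Mset k (c *: y).
Proof.
case=> p ->; exists (fun i a => sqrtC c * p i a); apply/colP => l.
rewrite !mxE big_distrr; apply: eq_bigr => a _.
by rewrite /= -mulrBr exprMn sqrtCK.
Qed.

(** The indicator of the edges leaving [A], realized by points 0 and 1 on a line; a vertex star when
    [A] is a singleton. *)
Definition cut A : 'cV[CC]_(Nc n) := mmap (fun i (_ : 'I_1) => (i \in A)%:R).

Lemma Mset_cut A : Mset 1 (cut A).
Proof. by exists (fun i (_ : 'I_1) => (i \in A)%:R). Qed.

Lemma entry_cut A i j : entry (cut A) i j = ((i \in A) != (j \in A))%:R.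
Proof.
by rewrite entry_mmap big_ord1; case: (i \in A); case: (j \in A) => /=; ring.
Qed.

(** In the star of [i] plus the star of [j] minus the cut of the pair, edges leaving the pair cancel
    and the edge itself counts twice. *)
Lemma delta_cut i j k : i != j -> vert k = [set i; j] ->
  delta_mx k 0 = 2^-1 *: cut [set i] + 2^-1 *: cut [set j] + - 2^-1 *: cut [set i; j].
Proof.
move=> neq_ij ek; apply: entry_inj => a b neq_ab.
rewrite !entryD !entryZ !entry_cut !inE.
have [l el] := vert_ex neq_ab; rewrite (entryE _ el) mxE andbT.
rewrite -(inj_eq (@vert_inj n)) el ek eq_set2.
have nz2 : 2 != 0 :> CC by rewrite pnatr_eq0.
have e2 : 2^-1 + 2^-1 = 1 :> CC by field.
have [ea|nai] := eqVneq a i; have [eb|nbj] := eqVneq b j;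
have [ea'|naj] := eqVneq a j; have [eb'|nbi] := eqVneq b i; subst => //=;
  rewrite ?eqxx // in neq_ij neq_ab *; rewrite ?mulr0 ?mulr1 ?addr0 ?add0r ?subrr ?e2 //.
Qed.

Lemma Mset1_span (R : Type) (g : 'cV[CC]_(Nc n) -> R) :
  (forall y b, Mset 1 b -> g (y + b) = g y) -> forall y, g y = g 0.
Proof.
move=> gM y; rewrite [y]matrix_sum_delta.
rewrite (eq_bigr (fun k => y k 0 *: delta_mx k 0)); last by move=> k _; rewrite big_ord1.
elim/big_rec: _ => // k z _ <-.
have [i [j [neq_ij ek]]] := vert_pair k.
rewrite (delta_cut neq_ij ek) !scalerDr addrC !addrA.
by rewrite !gM //; do 2!apply: MsetZ; apply: Mset_cut.
Qed.

(** Adding [b] in M_1 sends M_k into M_(k+1), so the difference of [g] along [b] vanishes by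
    induction. Then [g] is invariant along the spanning set M_1, hence constant. *)
Lemma diff_deg_Mset_eq0 k (g : 'cV[CC]_(Nc n) -> CC) :
  diff_deg k g -> (forall y, Mset k y -> g y = 0) -> forall y, g y = 0.
Proof.
elim: k g => [|k IH] g gd g0 y.
  by rewrite (gd y 0); apply/g0/Mset0.
rewrite (@Mset1_span _ g) => [|z b Mb]; first exact/g0/Mset0.
apply/eqP; rewrite -subr_eq0; apply/eqP.
apply: (IH (fun z => g (z + b) - g z)) => // {}z Mz.
rewrite !g0 ?subrr //; last exact: MsetD_Mset1.
by rewrite -[z]addr0; apply: MsetD_Mset1 => //; apply: Mset0.
Qed.

Lemma Lset_Mset d y : Mset d y -> exists2 x, Lset d x & sqmap x = y.
Proof.
move=> My; have e : sqmap (map_mx sqrtC y) = y.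
  by apply/colP => k; rewrite !mxE sqrtCK.
by exists (map_mx sqrtC y); rewrite // /Lset e.
Qed.

End MeasurementSets.

Lemma poly_eq0_all (F : numDomainType) (p : {poly F}) : (forall t, p.[t] = 0) -> p = 0.
Proof.
move=> p0; apply: (@roots_geq_poly_eq0 _ p [seq i%:R | i <- iota 0 (size p)]).
- by apply/allP => x _; apply/eqP/p0.
- by rewrite map_inj_uniq ?iota_uniq // => i j /eqP; rewrite eqr_nat => /eqP.
- by rewrite size_map size_iota.
Qed.

(** * Sign flips and the parity decomposition of polynomials *)

Section Flips.
Variable n : nat.
Implicit Types (x : 'cV[CC]_(Nc n)).

Definition flip (s : {set 'I_(Nc n)}) x : 'cV[CC]_(Nc n) :=
  \col_k ((-1) ^+ (k \in s) * x k 0).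

Lemma sqmap_flip s x : sqmap (flip s x) = sqmap x.
Proof. by apply/colP => k; rewrite !mxE exprMn sqrr_sign mul1r. Qed.

Lemma Lset_flip d s x : Lset d x -> Lset d (flip s x).
Proof. by rewrite /Lset sqmap_flip. Qed.

Definition odd_exps (m : 'X_{1.. Nc n}) : {set 'I_(Nc n)} := [set k | odd (m k)].

(* Writing h(x) = \sum_s x^s q_s(x^2) with s running over sets of coordinates,
   this is q_s as a function of y = x^2. *)
Definition parity_part (h : {mpoly CC[Nc n]}) (s : {set 'I_(Nc n)})
    (y : 'cV[CC]_(Nc n)) : CC :=
  \sum_(m <- msupp h | odd_exps m == s) h@_m * \prod_k y k 0 ^+ (m k)./2.

Lemma prod_exp_parity (m : 'X_{1.. Nc n}) x :
  \prod_k x k 0 ^+ m k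
  = (\prod_(k in odd_exps m) x k 0) * \prod_k sqmap x k 0 ^+ (m k)./2.
Proof.
rewrite [X in X * _]big_mkcond -big_split /=; apply: eq_bigr => k _.
rewrite mxE inE -exprM mul2n -{1}(odd_double_half (m k)) exprD.
by case: (odd _); rewrite ?expr1 ?expr0.
Qed.

(** Orthogonality of characters of the sign group: the sum factors over coordinates, and each factor
    is 2 or 0 according to whether the parities agree. *)
Lemma sum_sign_exps (s : {set 'I_(Nc n)}) (m : 'X_{1.. Nc n}) :
  \sum_(t : {set 'I_(Nc n)}) \prod_k ((-1) ^+ ((k \in t) && (k \in s))
     * ((-1) ^+ (k \in t)) ^+ m k) = (odd_exps m == s)%:R * 2 ^+ Nc n :> CC.
Proof.
have -> : \sum_(t : {set 'I_(Nc n)}) \prod_k ((-1) ^+ ((k \in t) && (k \in s))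
     * ((-1) ^+ (k \in t)) ^+ m k) = \sum_(f : {ffun 'I_(Nc n) -> bool})
       \prod_k ((-1) ^+ (f k && (k \in s)) * ((-1) ^+ f k) ^+ m k) :> CC.
  rewrite (reindex (fun f : {ffun 'I_(Nc n) -> bool} => [set k | f k])) /=.
    by apply: eq_bigr => f _; apply: eq_bigr => k _; rewrite inE.
  exists (fun t : {set _} => [ffun k => k \in t]) => [f _|t _].
    by apply/ffunP => k; rewrite ffunE inE.
  by apply/setP => k; rewrite inE ffunE.
rewrite -(bigA_distr_bigA (fun k (b : bool) =>
  (-1) ^+ (b && (k \in s)) * ((-1) ^+ b) ^+ m k : CC)).
have sumk k : \sum_(b : bool) (-1) ^+ (b && (k \in s)) * ((-1) ^+ b) ^+ m k
    = (odd (m k) == (k \in s))%:R * 2 :> CC.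
  rewrite big_bool /= expr0 expr1n mulr1 expr1 -[(-1) ^+ m k]signr_odd.
  by case: (odd _); case: (k \in s) => /=; ring.
rewrite (eq_bigr _ (fun k _ => sumk k)) big_split /= prodr_const card_ord.
congr (_ * _); have [<-|neq] := eqVneq.
  by apply: big1 => k _; rewrite inE eqxx.
have [k nk] : exists k, odd (m k) != (k \in s).
  apply/existsP; rewrite -negb_forall; apply: contra neq => /forallP e.
  by apply/eqP/setP => k; rewrite inE; apply/eqP.
by rewrite (bigD1 k) //= (negPf nk) mul0r.
Qed.

(** Projecting onto the character of [s] isolates one parity part, so vanishing on the flip-stable L
    passes to each part. *)
Lemma sum_flip (h : {mpoly CC[Nc n]}) (s : {set 'I_(Nc n)}) x :
  \sum_(t : {set 'I_(Nc n)}) (\prod_k (-1) ^+ ((k \in t) && (k \in s)))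
     * h.@[fun k => flip t x k 0]
  = 2 ^+ Nc n * ((\prod_(k in s) x k 0) * parity_part h s (sqmap x)).
Proof.
rewrite (eq_bigr _ (fun t _ => congr1 _ (mevalE _ h))).
under eq_bigr => t _ do rewrite big_distrr /=.
rewrite exchange_big /= big_distrr big_distrr big_mkcond [RHS]big_mkcond /=.
apply: eq_bigr => m _.
transitivity ((\sum_(t : {set 'I_(Nc n)}) \prod_k ((-1) ^+ ((k \in t) && (k \in s))
     * ((-1) ^+ (k \in t)) ^+ m k)) * (h@_m * \prod_k x k 0 ^+ m k)).
  rewrite big_distrl /=; apply: eq_bigr => t _.
  rewrite mulrCA [RHS]mulrCA; congr (_ * _); rewrite -!big_split /=.
  by apply: eq_bigr => k _; rewrite mxE exprMn mulrA.
rewrite sum_sign_exps; case: eqP => [<-|_]; last by rewrite !mul0r.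
rewrite mul1r; congr (_ * _); rewrite mulrCA; congr (_ * _).
by rewrite prod_exp_parity.
Qed.

Lemma meval_parity_part (h : {mpoly CC[Nc n]}) x :
  h.@[fun k => x k 0]
  = \sum_(s : {set 'I_(Nc n)}) (\prod_(k in s) x k 0) * parity_part h s (sqmap x).
Proof.
rewrite mevalE (partition_big odd_exps xpredT) //=; apply: eq_bigr => s _.
rewrite big_distrr; apply: eq_bigr => m /eqP <- /=.
rewrite mulrCA; congr (_ * _).
by rewrite prod_exp_parity.
Qed.

Lemma parity_part_diff_deg (h : {mpoly CC[Nc n]}) d s :
  (msize h <= (2 * d.+1).+1)%N -> s != set0 -> diff_deg d (parity_part h s).
Proof.
move=> hd /set0Pn[k0 k0s].
apply: (@diff_deg_ext _ _ _ (fun y : 'cV[CC]_(Nc n) => \sum_(m <- msupp h | (m \in msupp h)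
  && (odd_exps m == s)) h@_m * \prod_k y k 0 ^+ (m k)./2)) => [y|].
  by rewrite [RHS]big_seq_cond.
apply: diff_deg_sum => m /andP[mh /eqP es]; apply: diff_degZ.
have lin k : diff_deg 1 (fun y : 'cV[CC]_(Nc n) => y k 0).
  by move=> b y z; rewrite !mxE ![_ + b k 0]addrC !addrK.
apply: diff_deg_le (diff_deg_prod (index_enum _) (fun k => (m k)./2) lin).
have lt_m := leq_trans (msize_mdeg_lt mh) hd.
rewrite ltnS mdegE in lt_m.
have ok0 : odd (m k0) by move: k0s; rewrite -es inE.
(* Halving loses something at the odd exponent [k0], so the doubled sum is strictly below 2d+2 and
   the halves sum to at most [d]. *)
suff : ((\sum_k (m k)./2).*2 < \sum_k m k)%N by lia.
rewrite -mul2n big_distrr /= (bigD1 k0) //= [X in (_ < X)%N](bigD1 k0) //=.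
rewrite -addSn; apply: leq_add; first by have := odd_double_half (m k0); lia.
by apply: leq_sum => k _; have := odd_double_half (m k); lia.
Qed.

(* The factor x^s can be cancelled: along a line p + t q through any configuration p, with
   q collinear and injective, no squared distance vanishes identically in t. *)
Lemma parity_part_Mset (h : {mpoly CC[Nc n]}) d s y : (0 < d)%N ->
  (forall x, Lset d x -> h.@[fun k => x k 0] = 0) ->
  Mset d y -> parity_part h s y = 0.
Proof.
move=> d0 h0 [p ->].
have genM z : Mset d z -> (forall k, z k 0 != 0) -> parity_part h s z = 0.
  move=> /Lset_Mset[x Lx <-] nz; have := sum_flip h s x.
  rewrite big1 => [/esym/eqP|t _]; last by rewrite h0 ?mulr0 //; apply: Lset_flip.
  rewrite mulf_eq0 expf_eq0 pnatr_eq0 andbF /= mulf_eq0 => /orP[/prodf_eq0[k _]|/eqP //].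
  by have := nz k; rewrite mxE sqrf_eq0 => /negPf ->.
pose q (i : 'I_n) (a : 'I_d) : CC := if a == Ordinal d0 then i%:R else 0.
pose P k : {poly CC} := \sum_a ((p (val (ecoord k)).1 a - p (val (ecoord k)).2 a)%:P
   + (q (val (ecoord k)).1 a - q (val (ecoord k)).2 a)%:P * 'X) ^+ 2.
have PE t k : (P k).[t] = mmap (fun i a => p i a + t * q i a) k 0.
  rewrite mxE horner_sum; apply: eq_bigr => a _.
  by rewrite !hornerE; ring.
pose F : {poly CC} := \sum_(m <- msupp h | odd_exps m == s)
  h@_m *: \prod_k P k ^+ (m k)./2.
have FE t : F.[t] = parity_part h s (mmap (fun i a => p i a + t * q i a)).
  rewrite horner_sum; apply: eq_bigr => m _; rewrite hornerZ horner_prod.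
  by congr (_ * _); apply: eq_bigr => k _; rewrite horner_exp PE.
have P_nz k : P k != 0.
  apply/negP => /eqP Pk0.
  (* This second difference is twice the coefficient of t^2, a squared distance of the injective
     [q]. *)
  have : (P k).[1] + (P k).[-1] + - 2 * (P k).[0] = 0 by rewrite Pk0 !horner0; ring.
  have -> : (P k).[1] + (P k).[-1] + - 2 * (P k).[0] = 2 * mmap q k 0.
    rewrite !PE !mxE !big_distrr -!big_split; apply: eq_bigr => a _ /=.
    by ring.
  move/eqP; rewrite mulf_eq0 pnatr_eq0 /= mxE (bigD1 (Ordinal d0)) //= big1 => [|a na].
    rewrite addr0 sqrf_eq0 subr_eq0 /q eqxx eqr_nat => /eqP /val_inj /eqP.
    by rewrite (negPf (vert_neq k)).
  by rewrite /q (negPf na) subrr expr0n.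
(* At each [t] either all squared distances are nonzero and [genM] applies, or the product
   vanishes. *)
have : F * \prod_k P k = 0.
  apply: poly_eq0_all => t; rewrite hornerM horner_prod.
  have [nz|] := boolP [forall k, (P k).[t] != 0].
    rewrite FE genM ?mul0r //; first by eexists; reflexivity.
    by move=> k; rewrite -PE; apply: (forallP nz).
  rewrite negb_forall => /existsP[k]; rewrite negbK => /eqP Pk0.
  by rewrite (bigD1 k) //= Pk0 mul0r mulr0.
move/eqP; rewrite mulf_eq0 => /orP[/eqP F0|]; last first.
  by move/prodf_eq0 => [k _]; rewrite (negPf (P_nz k)).
have := FE 0; rewrite F0 horner0 => ->; congr (parity_part h s _).
by apply/colP => k; rewrite !mxE; apply: eq_bigr => a _; rewrite !mul0r !addr0.
Qed.

(** Only the part with [s] empty survives, and it sees [x] through its squares alone. *)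
Lemma meval_flip (h : {mpoly CC[Nc n]}) d t x : (0 < d)%N ->
  (msize h <= (2 * d.+1).+1)%N ->
  (forall x, Lset d x -> h.@[fun k => x k 0] = 0) ->
  h.@[fun k => flip t x k 0] = h.@[fun k => x k 0].
Proof.
move=> d0 hd h0; rewrite !meval_parity_part sqmap_flip; apply: eq_bigr => s _.
have [->|nz_s] := eqVneq s set0; first by rewrite !big_set0.
rewrite (_ : parity_part _ _ _ = 0) ?mulr0 //.
apply: (diff_deg_Mset_eq0 (parity_part_diff_deg hd nz_s)) => y.
exact: parity_part_Mset.
Qed.

End Flips.

(** * Rank and degree bounds for determinants *)

Lemma det_rank_lt (F : fieldType) m (X : 'M[F]_m) : (\rank X < m)%N -> \det X = 0.
Proof.
move=> lt; apply/eqP; apply: contraTT lt.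
by rewrite -unitfE -unitmxE -row_free_unit -leqNgt /row_free => /eqP e; apply: eq_leq.
Qed.

Lemma msize_prod_le (R : idomainType) N (I : Type) (r : seq I) (c : nat)
    (F : I -> {mpoly R[N]}) :
  (forall i, msize (F i) <= c.+1)%N -> (msize (\prod_(i <- r) F i) <= (c * size r).+1)%N.
Proof.
move=> Fc; elim: r => [|i r IH]; first by rewrite big_nil msize1.
rewrite big_cons /=; set Q := \prod_(j <- r) _ in IH *.
have [->|nzF] := eqVneq (F i) 0; first by rewrite mul0r msize0.
have [->|nzQ] := eqVneq Q 0; first by rewrite mulr0 msize0.
by rewrite msizeM //; have := Fc i; lia.
Qed.

Lemma msize_det_le (R : idomainType) N m (c : nat) (X : 'M[{mpoly R[N]}]_m) :
  (forall i j, msize (X i j) <= c.+1)%N -> (msize (\det X) <= (c * m).+1)%N.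
Proof.
move=> Xc; apply: (leq_trans (msize_sum _ _ _)); apply/bigmax_leqP => s _.
have -> : msize ((-1) ^+ s * \prod_i X i (s i)) = msize (\prod_i X i (s i)).
  by case: (odd_perm s); rewrite ?expr1 ?expr0 ?mul1r ?mulN1r ?msizeN.
apply: (leq_trans (msize_prod_le (c := c) _ _)) => //.
by rewrite -sum1_size big_const_ord iter_addn mul1n addn0.
Qed.

(** * Gram minors, and why A is monomial *)

Section Gram.
Variable n : nat.
Implicit Types (x y z : 'cV[CC]_(Nc n)) (b : 'I_n).

(* Twice the Gram matrix of the vectors p_i - p_b, expressed in squared distances. *)
Definition gram b y : 'M[CC]_n :=
  \matrix_(i, j) (entry y b i + entry y b j - entry y i j).

Lemma gram_mmap d b (p : 'I_n -> 'I_d -> CC) (U := \matrix_(i, a) (p i a - p b a)) :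
  gram b (mmap p) = (2 *: U) *m U^T.
Proof.
apply/matrixP => i j; rewrite !mxE !entry_mmap -sumrN -!big_split.
by apply: eq_bigr => a _; rewrite !mxE /=; ring.
Qed.

(** Up to sign, the Cayley-Menger determinant of the d+2 vertices consisting of [b] and the values
    of [g]. *)
Definition gram_minor d b (g : 'I_d.+1 -> 'I_n) y : CC := \det (mxsub g g (gram b y)).

Lemma gram_minor_Mset d b (g : 'I_d.+1 -> 'I_n) y : Mset d y -> gram_minor b g y = 0.
Proof.
case=> p ->; rewrite /gram_minor gram_mmap.
set X := 2 *: _; set Y := _^T.
have -> : mxsub g g (X *m Y) = rowsub g X *m colsub g Y.
  by apply/matrixP => i j; rewrite !mxE; apply: eq_bigr => a _; rewrite !mxE.
by rewrite det_rank_lt // (leq_ltn_trans (mxrankM_maxl _ _)) // ltnS rank_leq_col.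
Qed.

(** The minor is a polynomial [h] in [x] of degree at most 2(d+1), since its entries are quadratic,
    and it vanishes on L because A preserves L. *)
Lemma gram_minor_flip d b (g : 'I_d.+1 -> 'I_n) (A : 'M[CC]_(Nc n)) t x :
  (0 < d)%N -> (forall x, Lset d x -> Lset d (A *m x)) ->
  gram_minor b g (sqmap (A *m flip t x)) = gram_minor b g (sqmap (A *m x)).
Proof.
move=> d0 LA.
pose E i j : {mpoly CC[Nc n]} :=
  \sum_(k | vert k == [set i; j]) (\sum_l A k l *: 'X_l) ^+ 2.
pose h : {mpoly CC[Nc n]} := \det (\matrix_(i, j) (E b (g i) + E b (g j) - E (g i) (g j))).
have EE i j (z : 'cV[CC]_(Nc n)) : (E i j).@[fun k => z k 0] = entry (sqmap (A *m z)) i j.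
  rewrite /E raddf_sum; apply: eq_bigr => k _; rewrite !mxE /= rmorphXn /= raddf_sum.
  by congr (_ ^+ 2); apply: eq_bigr => l _; rewrite /= mevalZ mevalXU.
have hE (z : 'cV[CC]_(Nc n)) : h.@[fun k => z k 0] = gram_minor b g (sqmap (A *m z)).
  rewrite /h -det_map_mx; congr (\det _); apply/matrixP => i j.
  by rewrite !mxE /= mevalB mevalD !EE.
have Es i j : (msize (E i j) <= 3)%N.
  apply: (leq_trans (msize_sum _ _ _)); apply/bigmax_leqP => k _.
  set Q := \sum_l _; have s1 : (msize Q <= 2)%N.
    apply: (leq_trans (msize_sum _ _ _)); apply/bigmax_leqP => l _.
    by apply: leq_trans (msizeZ_le _ _) _; rewrite msizeX mdeg1.
  have [->|nz] := eqVneq Q 0; first by rewrite expr0n msize0.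
  by rewrite expr2 msizeM //; move: s1; set u := mmeasure _ _; lia.
rewrite -!hE; apply: (@meval_flip _ h d) => // [|z Lz].
  apply: msize_det_le => i j; rewrite mxE.
  apply: leq_trans (msizeD_le _ _) _; rewrite msizeN geq_max Es andbT.
  by apply: leq_trans (msizeD_le _ _) _; rewrite geq_max !Es.
by rewrite hE; apply/gram_minor_Mset/LA.
Qed.

Lemma gram_minor_local d b (g : 'I_d.+1 -> 'I_n) y z e w :
  w \in vert e -> b != w -> (forall a, g a != w) ->
  (forall k, k != e -> y k 0 = z k 0) -> gram_minor b g y = gram_minor b g z.
Proof.
move=> we bw gw yz; congr (\det _); apply/matrixP => i j; rewrite !mxE.
have ent u v : u != w -> v != w -> entry y u v = entry z u v.
  move=> uw vw; apply: eq_bigr => k /eqP ek; apply: yz.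
  apply: contraTneq we => <-; rewrite ek !inE negb_or.
  by rewrite eq_sym uw eq_sym vw.
by rewrite !ent.
Qed.

(** Supplies the vertex set K. Both [i] and [j] index rows of the minor, and [n >= d+3] leaves room
    to omit [w]. *)
Lemma frame_avoiding d (i j w : 'I_n) :
  (0 < d)%N -> (d + 3 <= n)%N -> i != j -> w != i -> w != j ->
  exists b (g : 'I_d.+1 -> 'I_n), [/\ injective g, forall a, g a != b,
    forall a, g a != w, [/\ b != w, b != i & b != j] &
    exists a1 a2, [/\ a1 != a2, g a1 = i & g a2 = j]].
Proof.
case: d => // d _ hn ij wi wj.
pose r := enum (~: [set i; j; w]); pose t := [:: i, j & r].
have size_t : (d + 3 <= size t)%N.
  have : (#|[set i; j; w]| <= 3)%N.
    apply: leq_trans (leq_card_setU _ _) _; rewrite cards1 cards2.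
    by case: (i != j).
  by rewrite /t /= -cardE cardsCs setCK card_ord; set c := #|_|; lia.
have uniq_t : uniq t.
  by rewrite /= enum_uniq !inE !mem_enum !inE (negPf ij) !eqxx ?orbT.
have wt : w \notin t by rewrite !inE mem_enum !inE eqxx !orbT (negPf wi) (negPf wj).
have nth_w m : (m < size t)%N -> nth i t m != w.
  by move=> lt; apply: contraNneq wt => <-; apply: mem_nth.
have nth_neq m1 m2 : (m1 < size t)%N -> (m2 < size t)%N ->
    (nth i t m1 == nth i t m2) = (m1 == m2) by move=> l1 l2; apply: nth_uniq.
(* Positions 0 and 1 of [t] hold [i] and [j]; position 2 is reserved for the base [b], so [f] skips
   it. *)
pose f (a : nat) := if (a < 2)%N then a else a.+1.
have flt (a : 'I_d.+2) : (f a < size t)%N by have := ltn_ord a; rewrite /f; case: ifP; lia.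
have lt2 : (2 < size t)%N by lia.
exists (nth i t 2), (fun a : 'I_d.+2 => nth i t (f a)); split.
- move=> a a' /eqP; rewrite nth_neq // => /eqP; rewrite /f => e.
  by apply: val_inj => /=; move: e; do 2!case: ifP; lia.
- by move=> a; rewrite nth_neq // /f; case: ifP; lia.
- by move=> a; apply: nth_w.
- by split; [exact: nth_w | rewrite (nth_neq 2 0)%N //; lia | rewrite (nth_neq 2 1)%N //; lia].
by exists ord0, (lift ord0 ord0).
Qed.

(** Take squared distances 1 to [b] and 2 elsewhere, except [c] on [e]. For [c = 2] the matrix is
    twice the identity; for [c = 0] its rows [a1] and [a2] coincide. *)
Lemma gram_minor_dep d b (g : 'I_d.+1 -> 'I_n) e a1 a2 :
  injective g -> (forall a, g a != b) -> b \notin vert e ->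
  a1 != a2 -> vert e = [set g a1; g a2] ->
  exists x c, gram_minor b g (sqmap (x + c *: delta_mx e 0)) != gram_minor b g (sqmap x).
Proof.
move=> g_inj gb be neq_a ea.
pose Y c : 'cV[CC]_(Nc n) := \col_k (if k == e then c else if b \in vert k then 1 else 2).
have YE c : sqmap (map_mx sqrtC (Y c)) = Y c by apply/colP => k; rewrite !mxE sqrtCK.
exists (map_mx sqrtC (Y 0)), (sqrtC 2).
have -> : map_mx sqrtC (Y 0) + sqrtC 2 *: delta_mx e 0 = map_mx sqrtC (Y 2).
  apply/colP => k; rewrite !mxE andbT.
  by case: eqP => _; rewrite ?sqrtC0 ?add0r ?mulr1 ?mulr0 ?addr0.
rewrite !YE.
have Yb c a : entry (Y c) b (g a) = 1.
  have /vert_ex[k ek] : b != g a by rewrite eq_sym.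
  rewrite (entryE _ ek) mxE ek !inE eqxx /=; case: eqP => // eke.
  by case/negP: be; rewrite -eke ek !inE eqxx.
have Yg c a a' : a != a' -> entry (Y c) (g a) (g a') =
    if [set a; a'] == [set a1; a2] then c else 2.
  move=> neq; have /vert_ex[k ek] : g a != g a' by rewrite (inj_eq g_inj).
  rewrite (entryE _ ek) mxE -(inj_eq (@vert_inj n)) ek ea !eq_set2 !(inj_eq g_inj).
  by rewrite !inE ![b == _]eq_sym !(negPf (gb _)).
have -> : gram_minor b g (Y 2) = 2 ^+ d.+1.
  rewrite /gram_minor (_ : mxsub _ _ _ = 2%:M) ?det_scalar //.
  apply/matrixP => a a'; rewrite !mxE !Yb.
  have [<-|neq] := eqVneq a a'; first by rewrite entry_diag subr0.
  by rewrite Yg // if_same subrr.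
have -> : gram_minor b g (Y 0) = 0.
  apply: (determinant_alternate neq_a) => a; rewrite !mxE !Yb.
  have [<-|n1] := eqVneq a1 a.
    by rewrite entry_diag Yg 1?eq_sym // setUC eqxx.
  rewrite Yg //; have [<-|n2] := eqVneq a2 a; first by rewrite entry_diag eqxx.
  rewrite Yg // !eq_set2 !eqxx /= ![a == _]eq_sym (negPf n1) (negPf n2) /= andbF.
  by rewrite andbF.
by rewrite expf_neq0 // pnatr_eq0.
Qed.

Lemma lin_aut_inv_support d (A : 'M[CC]_(Nc n)) e e0 e1 :
  (0 < d)%N -> (d + 3 <= n)%N -> lin_aut d A ->
  A e0 e != 0 -> e1 != e0 -> invmx A e e1 = 0.
Proof.
move=> d0 hn [uA [LA _]] Ae0 ne1; apply/eqP/negP => /negP f1.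
have [i [j [ij ei]]] := vert_pair e0.
have [w we1 we0] : exists2 w, w \in vert e1 & w \notin vert e0.
  apply/subsetPn; apply: contra ne1 => sub.
  by rewrite -(inj_eq (@vert_inj n)) eqEcard sub !card_vert.
move: (we0); rewrite ei !inE negb_or => /andP[wi wj].
have [b [g [g_inj gb gw [bw bi bj] [a1 [a2 [neq_a ga1 ga2]]]]]] :=
  frame_avoiding d0 hn ij wi wj.
pose P z := gram_minor b g (sqmap z); pose v := col e A.
pose f z := (invmx A *m z) e 0.
(* The reflection is the flip at [e] conjugated by A. *)
have P_refl z : P (z - (2 * f z) *: v) = P z.
  transitivity (P (A *m flip [set e] (invmx A *m z))); last first.
    by rewrite /P gram_minor_flip // mulKVmx.
  congr (P _); rewrite -{1}(mulKVmx uA z); apply/colP => k.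
  rewrite !mxE (bigD1 e) //= [RHS](bigD1 e) //= !mxE inE eqxx -/(f z).
  have -> : \sum_(l | l != e) A k l * flip [set e] (invmx A *m z) l 0
    = \sum_(l | l != e) A k l * (invmx A *m z) l 0.
    by apply: eq_bigr => l nl; rewrite mxE inE (negPf nl) mul1r.
  by rewrite /f mxE; ring.
have P_loc z c : P (z + c *: delta_mx e1 0) = P z.
  apply: (gram_minor_local we1) => // k nk.
  by rewrite !mxE (negPf nk) mulr0 addr0.
have P_v z c : P (z + c *: v) = P z.
  (* Chosen so that moving by [l] along [e1] brings [f] to [- c / 2], where the reflection is
     translation by [c *: v]. *)
  pose l := (- c / 2 - f z) / invmx A e e1.
  rewrite -(P_loc z l) -(P_refl (z + l *: _)) -(P_loc _ l); congr (P _).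
  have -> : f (z + l *: delta_mx e1 0) = - c / 2.
    have -> : f (z + l *: delta_mx e1 0) = f z + l * invmx A e e1.
      by rewrite /f mulmxDr -scalemxAr -colE !mxE.
    by rewrite divfK // addrC subrK.
  by apply/colP => k; rewrite !mxE; field.
have P_flip z : P (flip [set e0] z) = P z by rewrite /P sqmap_flip.
have P_e0 z c : P (z + c *: delta_mx e0 0) = P z.
  (* With this choice, flipping [z + c *: delta_mx e0 0 - c' *: v] at [e0] gives the flip of [z]
     minus [c' *: v]. *)
  pose c' := c / (2 * A e0 e).
  rewrite -(P_v _ (- c')) -P_flip -[RHS]P_flip -[RHS](P_v _ (- c')); congr (P _).
  apply/colP => k; rewrite !mxE !inE andbT; case: eqP => [->|_]; last by rewrite /=; ring.
  by rewrite /= /c'; field; rewrite Ae0.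
have be0 : b \notin vert e0 by rewrite ei !inE negb_or bi bj.
have [|x [c /eqP]] := gram_minor_dep g_inj gb be0 neq_a; first by rewrite ga1 ga2.
by apply; apply: P_e0.
Qed.

(** Two nonzero entries in column [e] would confine row [e] of the inverse to two different single
    positions, making it zero. *)
Lemma lin_aut_monomial d (A : 'M[CC]_(Nc n)) e :
  (0 < d)%N -> (d + 3 <= n)%N -> lin_aut d A ->
  exists2 e0, A e0 e != 0 & forall e1, e1 != e0 -> A e1 e = 0.
Proof.
move=> d0 hn hA; have uA := hA.1.
have [e0 Ae0] : exists e0, A e0 e != 0.
  apply/existsP; rewrite -negb_forall; apply/negP => /forallP A0.
  have := congr1 (fun M : 'M[CC]_(Nc n) => M e e) (mulVmx uA).
  rewrite !mxE eqxx big1 => [/eqP|k _]; first by rewrite eq_sym oner_eq0.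
  by rewrite (eqP (A0 k)) mulr0.
exists e0 => // e1 ne1; apply/eqP/negP => /negP Ae1.
have := congr1 (fun M : 'M[CC]_(Nc n) => M e e) (mulVmx uA).
rewrite !mxE eqxx big1 => [/eqP|k _]; first by rewrite eq_sym oner_eq0.
have [->|nk] := eqVneq k e0.
  by rewrite (lin_aut_inv_support d0 hn hA Ae1) ?mul0r // eq_sym.
by rewrite (lin_aut_inv_support d0 hn hA Ae0) ?mul0r.
Qed.

End Gram.

(** * Symmetric matrices: factorization and rank-preserving variations *)

Section SymmetricRank.
Variable C : numClosedFieldType.

(** If no basis vector is anisotropic, the sum of two basis vectors with [G i j] nonzero is; a
    square root normalizes the value. *)
Lemma sym_anisotropic m (G : 'M[C]_m) : G^T = G -> G != 0 ->
  exists w : 'rV[C]_m, (w *m G *m w^T) 0 0 = 1.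
Proof.
move=> symG nzG.
suff [w nz] : exists w : 'rV[C]_m, (w *m G *m w^T) 0 0 != 0.
  exists ((sqrtC ((w *m G *m w^T) 0 0))^-1 *: w).
  rewrite linearZ /= -scalemxAr -!scalemxAl scalerA mxE -invfM -expr2 sqrtCK.
  by rewrite mulVf.
have dG i j : (delta_mx 0 i *m G *m (delta_mx 0 j)^T : 'M_1) 0 0 = G i j.
  by rewrite trmx_delta -rowE -colE !mxE.
have [i nz|G0] := pickP (fun i => G i i != 0).
  by exists (delta_mx 0 i); rewrite dG.
have [i /existsP[j nz]] : exists i, [exists j, G i j != 0].
  apply/existsP; apply: contraR nzG; rewrite negb_exists => /forallP G00.
  apply/eqP/matrixP => i j; rewrite mxE; apply/eqP.
  by have := G00 i; rewrite negb_exists => /forallP/(_ j); rewrite negbK.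
exists (delta_mx 0 i + delta_mx 0 j).
rewrite linearD /= mulmxDr !mulmxDl mxE mxE [X in _ + X]mxE !dG.
rewrite (eqP (negbFE (G0 i))) (eqP (negbFE (G0 j))) add0r addr0.
have -> : G j i = G i j by rewrite -{1}symG mxE.
by rewrite -mulr2n mulrn_eq0.
Qed.

(** Subtracting [u^T *m u] with [u = w *m G] keeps the kernel and adds [w] to it, so the rank
    drops. *)
Lemma sym_factor m k (G : 'M[C]_m) : G^T = G -> (\rank G <= k)%N ->
  exists Q : 'M[C]_(m, k), G = Q *m Q^T.
Proof.
elim: k G => [|k IH] G symG.
  by rewrite leqn0 mxrank_eq0 => /eqP ->; exists 0; rewrite mul0mx.
move=> rG; have [->|nzG] := eqVneq G 0; first by exists 0; rewrite mul0mx.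
have [w w1] := sym_anisotropic symG nzG.
pose u := w *m G; pose G' := G - u^T *m u.
have uw : u *m w^T = 1%:M by apply/matrixP => i j; rewrite !ord1 !mxE eqxx -w1 mxE.
have ut : u^T = G *m w^T by rewrite trmx_mul symG.
have [||Q' eQ'] := IH G'.
- by rewrite linearB /= trmx_mul trmxK symG.
- have lt : (kermx G < kermx G')%MS.
    apply/andP; split.
      apply/sub_kermxP; rewrite mulmxBr mulmx_ker ut !mulmxA.
      by rewrite mulmx_ker !mul0mx subrr.
    apply: contraTN isT => /(submx_trans _) sub.
    have /sub : (w <= kermx G')%MS.
      apply/sub_kermxP; rewrite mulmxBr -/u ut !mulmxA -/u.
      by rewrite uw mul1mx subrr.
    move/sub_kermxP => u0; have := congr1 (fun M : 'M_1 => M 0 0) uw.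
    by rewrite /u u0 mul0mx !mxE /= => /eqP; rewrite eq_sym oner_eq0.
  have := rank_ltmx lt; rewrite !mxrank_ker.
  by have := rank_leq_row G; move: rG; set a := \rank G; set c := \rank G'; lia.
exists (row_mx u^T Q' : 'M_(m, 1 + k)).
have := mul_row_col u^T Q' u Q'^T; rewrite -eQ' addrC subrK => <-.
by congr (_ *m _); rewrite -{1}[u]trmxK -tr_row_mx.
Qed.

(* At a symmetric matrix of rank r, first-order variations that keep the rank at most r
   vanish as quadratic forms on the kernel: this is the t^1 coefficient of an
   (r+1)-minor of G + tB. *)
Lemma sym_rank_tangent m r (G B : 'M[C]_m) (u : 'rV[C]_m) :
  G^T = G -> \rank G = r -> u *m G = 0 ->
  (forall t, \rank (G + t *: B)%R <= r)%N -> (u *m B *m u^T) 0 0 = 0.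
Proof.
move=> symG rG uG rB.
have [|Q eQ] := @sym_factor m r G symG; first by rewrite rG.
have /row_fullP[X XQ] : row_full Q.
  by rewrite /row_full eqn_leq rank_leq_col -{1}rG eQ mxrankM_maxl.
have XGX : X *m G *m X^T = 1%:M.
  by rewrite eQ mulmxA XQ mul1mx -trmx_mul XQ trmx1.
have Gu : G *m u^T = 0 by rewrite -[G]symG -trmx_mul uG trmx0.
pose pC k l (M : 'M[C]_(k, l)) : 'M[{poly C}]_(k, l) := map_mx polyC M.
(* The matrix of G + tB in the frame [X], [u], with a factor t taken out of the last row; at t = 0
   its determinant is the value of B at [u]. *)
pose N : 'M[{poly C}]_(r + 1) :=
  block_mx (1%:M + 'X *: pC _ _ (X *m B *m X^T)) ('X *: pC _ _ (X *m B *m u^T))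
           (pC _ _ (u *m B *m X^T)) (pC _ _ (u *m B *m u^T)).
pose Nt t : 'M[C]_(r + 1) :=
  block_mx (1%:M + t *: (X *m B *m X^T)) (t *: (X *m B *m u^T))
           (u *m B *m X^T) (u *m B *m u^T).
have NE t : (\det N).[t] = \det (Nt t).
  rewrite -[LHS]/(horner_eval t (\det N)) -det_map_mx; congr (\det _).
  rewrite map_block_mx /Nt; congr block_mx; apply/matrixP => i j.
  - by rewrite !mxE /= /horner_eval hornerD hornerMn hornerC hornerM hornerX hornerC.
  - by rewrite !mxE /= /horner_eval hornerM hornerX hornerC.
  - by rewrite !mxE /= /horner_eval hornerC.
  - by rewrite !mxE /= /horner_eval hornerC.
have N0 : \det N * 'X = 0.
  apply: poly_eq0_all => t; rewrite hornerMX NE.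
  have <- : \det (block_mx 1%:M 0 0 t%:M *m Nt t) = \det (Nt t) * t.
    by rewrite det_mulmx det_ublock det1 mul1r det_scalar1 mulrC.
  rewrite mulmx_block !mul1mx !mul0mx !addr0 !add0r !mul_scalar_mx.
  suff -> : block_mx (1%:M + t *: (X *m B *m X^T)) (t *: (X *m B *m u^T))
      (t *: (u *m B *m X^T)) (t *: (u *m B *m u^T))
      = col_mx X u *m (G + t *: B) *m (col_mx X u)^T.
    apply/det_rank_lt/(@leq_ltn_trans r); last by rewrite addn1.
    by rewrite (leq_trans (mxrankM_maxl _ _)) // (leq_trans (mxrankM_maxr _ _)).
  rewrite tr_col_mx mul_col_mx mul_col_row.
  rewrite !mulmxDr !mulmxDl -!scalemxAr -!scalemxAl XGX uG !mul0mx.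
  by rewrite -[X *m G *m u^T]mulmxA Gu mulmx0 !add0r.
move/eqP: N0; rewrite mulf_eq0 polyX_eq0 orbF => /eqP N0.
have := NE 0; rewrite N0 horner0 /Nt !scale0r addr0 det_lblock det1 mul1r.
by rewrite det_mx11 => <-.
Qed.

End SymmetricRank.

Lemma lin_form_row (R : comNzRingType) N (phi : 'cV[R]_N -> R) :
  (forall y z, phi (y + z) = phi y + phi z) ->
  (forall c y, phi (c *: y) = c * phi y) ->
  forall y, phi y = ((\row_k phi (delta_mx k 0)) *m y) 0 0.
Proof.
move=> phiD phiZ y; have phi0 : phi 0 = 0 by rewrite -(scale0r 0) phiZ mul0r.
rewrite mxE {1}[y]matrix_sum_delta (big_morph phi phiD phi0).
by apply: eq_bigr => k _; rewrite big_ord1 phiZ mxE mulrC.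
Qed.

(** * Descent from M_d to M_1 *)

Section Descent.
Variable n : nat.
Implicit Types (x y z : 'cV[CC]_(Nc n)) (b : 'I_n).

Lemma gram_sym b y : (gram b y)^T = gram b y.
Proof. by apply/matrixP => i j; rewrite !mxE (entryC y j i) [X in X - _]addrC. Qed.

Lemma gramD b y z : gram b (y + z) = gram b y + gram b z.
Proof. by apply/matrixP => i j; rewrite !mxE !entryD; ring. Qed.

Lemma gramZ b c y : gram b (c *: y) = c *: gram b y.
Proof. by apply/matrixP => i j; rewrite !mxE !entryZ; ring. Qed.

(** The rows of a factor [Q] are the points, divided by [sqrtC 2] because [gram] is twice a Gram
    matrix. *)
Lemma Mset_gram k b y : Mset k y <-> (\rank (gram b y) <= k)%N.
Proof.
split=> [[p ->]|/(sym_factor (gram_sym b y))[Q eQ]].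
  by rewrite gram_mmap (leq_trans (mxrankM_maxl _ _)) ?rank_leq_col.
exists (fun i a => Q i a / sqrtC 2); apply: entry_inj => i j _.
have G i' j' : \sum_a Q i' a * Q j' a = entry y b i' + entry y b j' - entry y i' j'.
  have := congr1 (fun M : 'M_n => M i' j') eQ; rewrite !mxE => ->.
  by apply: eq_bigr => a _; rewrite mxE.
have nz2 : 2 != 0 :> CC by rewrite pnatr_eq0.
rewrite entry_mmap.
transitivity (\sum_a 2^-1 * (Q i a * Q i a + Q j a * Q j a + (- 2) * (Q i a * Q j a))).
  rewrite -big_distrr /= !big_split -big_distrr /= !G !entry_diag.
  by field.
apply: eq_bigr => a _; rewrite -mulrBl expr_div_n sqrtCK.
by field.
Qed.

Lemma Mset_tangent_span k y (l : 'rV[CC]_(Nc n)) : Mset k y ->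
  (forall z, (forall t, Mset k.+1 (y + t *: z)) -> l *m z = 0) -> l = 0.
Proof.
move=> My l0.
have lM z : Mset 1 z -> l *m z = 0.
  by move=> Mz; apply: l0 => t; apply/MsetD_Mset1/MsetZ.
have l00 z : l *m z = l *m 0.
  by apply: (@Mset1_span n _ (mulmx l)) => x w Mw; rewrite mulmxDr (lM w) // addr0.
apply/rowP => j; have := l00 (delta_mx j 0); rewrite mulmx0 -colE.
by move=> /matrixP/(_ 0 0); rewrite !mxE.
Qed.

Lemma Mset_of_tangent_span k y : (k + 3 <= n)%N -> Mset k.+1 y ->
  (forall l : 'rV[CC]_(Nc n),
     (forall z, (forall t, Mset k.+1 (y + t *: z)) -> l *m z = 0) -> l = 0) ->
  Mset k y.
Proof.
move=> hn My lspan.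
have b : 'I_n by case: (n) hn => [|n' _]; [rewrite addn3 | exact: ord0].
apply/(Mset_gram _ b); case: leqP => // lt_k.
have rG : \rank (gram b y) = k.+1.
  by apply/eqP; rewrite eqn_leq lt_k andbT; apply/(Mset_gram _ b).
(* The basis vector at [b] is always in the kernel and gives the zero form; [k+3 <= n] makes the
   kernel at least two-dimensional, so another [u] exists. *)
have [i nsub] : exists i, ~~ (row i (kermx (gram b y)) <= (delta_mx 0 b : 'rV[CC]_n))%MS.
  apply/row_subPn; apply/negP => /mxrankS; rewrite mxrank_ker rG mxrank_delta.
  by move: hn; lia.
pose u := row i (kermx (gram b y)).
have uG : u *m gram b y = 0 by rewrite -row_mul mulmx_ker row0.
have [j jb uj] : exists2 j, j != b & u 0 j != 0.
  apply/exists_inP; apply: contraR nsub; rewrite negb_exists_in => /forall_inP u0.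
  apply/sub_rVP; exists (u 0 b); apply/rowP => j; rewrite [RHS]mxE [delta_mx _ _ _ _]mxE /=.
  have [->|nj] := eqVneq j b; first by rewrite mulr1.
  by rewrite mulr0; apply/eqP/negbNE/u0.
clearbody u; pose phi z := (u *m gram b z *m u^T) 0 0.
have phiD z w : phi (z + w) = phi z + phi w.
  by rewrite /phi gramD mulmxDr mulmxDl mxE.
have phiZ c z : phi (c *: z) = c * phi z.
  by rewrite /phi gramZ -scalemxAr -scalemxAl mxE.
have /lspan row0 : forall z, (forall t, Mset k.+1 (y + t *: z)) ->
    (\row_l phi (delta_mx l 0)) *m z = 0.
  move=> z Mz; apply/matrixP => i1 i2; rewrite !ord1 -lin_form_row // mxE.
  apply: (sym_rank_tangent (gram_sym b y) rG uG) => t.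
  by rewrite -gramZ -gramD; apply/Mset_gram.
have phi0 z : phi z = 0 by rewrite (lin_form_row phiD phiZ) row0 mul0mx mxE.
have := phi0 (cut [set j]); rewrite /phi.
have -> : gram b (cut [set j]) = 2 *: delta_mx j j.
  apply/matrixP => i1 i2; rewrite !mxE !entry_cut !inE [b == j]eq_sym (negPf jb).
  by case: (i1 == j); case: (i2 == j) => /=; ring.
rewrite -scalemxAr -scalemxAl mxE -(mul_delta_mx (0 : 'I_1)) mulmxA -colE -mulmxA -rowE.
rewrite mxE big_ord1 !mxE => /eqP; rewrite !mulf_eq0 pnatr_eq0 /= orbb.
by rewrite (negPf uj).
Qed.

(** B carries allowed directions at [y] to allowed directions at [B *m y], so a form [l] killing the
    latter gives [l *m B] killing the former. *)
Lemma Mset_descent k (B : 'M[CC]_(Nc n)) : (k + 3 <= n)%N ->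
  (forall l : 'rV_(Nc n), l *m B = 0 -> l = 0) ->
  (forall y, Mset k.+1 y -> Mset k.+1 (B *m y)) ->
  forall y, Mset k y -> Mset k (B *m y).
Proof.
move=> hn injB MB y My; apply: Mset_of_tangent_span => // [|l l0].
  by apply: MB; rewrite -[y]addr0; apply: MsetD_Mset1 => //; apply: Mset0.
apply/injB/(Mset_tangent_span My) => z Mz; rewrite -mulmxA; apply: l0 => t.
by rewrite scalemxAr -mulmxDr; apply: MB.
Qed.

Lemma Mset_descent1 d (B : 'M[CC]_(Nc n)) : (0 < d)%N -> (d + 3 <= n)%N ->
  (forall l : 'rV_(Nc n), l *m B = 0 -> l = 0) ->
  (forall y, Mset d y -> Mset d (B *m y)) ->
  forall y, Mset 1 y -> Mset 1 (B *m y).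
Proof.
case: d => // d _; elim: d => // d IH hn injB MB; apply: IH => //; first by lia.
by apply: Mset_descent => //; lia.
Qed.

End Descent.

(** * Vertex stars as the small-support vectors of M_1 *)

Section Stars.
Variable n : nat.
Implicit Types (e : 'I_(Nc n)) (v w : 'I_n).

Lemma cut1E v e : cut [set v] e 0 = (v \in vert e)%:R.
Proof.
have [i [j [ij ei]]] := vert_pair e; rewrite -(entryE _ ei) entry_cut ei !inE.
rewrite ![v == _]eq_sym; have [ev|_] := eqVneq i v; last by case: (j == v).
by rewrite -ev [j == i]eq_sym (negPf ij).
Qed.

Lemma card_star v : (#|[set e : 'I_(Nc n) | v \in vert e]| < n)%N.
Proof.
have -> : #|[set e : 'I_(Nc n) | v \in vert e]|
    = #|(fun e => vert e :\ v) @: [set e | v \in vert e]|.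
  apply/esym/card_in_imset => e e'; rewrite inE => ve; rewrite inE => ve' eq.
  by apply: vert_inj; rewrite -(setD1K ve) -(setD1K ve') eq.
apply: (@leq_ltn_trans #|set1 @: [set~ v]|).
  apply/subset_leq_card/subsetP => U /imsetP[e]; rewrite inE => ve ->.
  have /cards1P[w ew] : #|vert e :\ v| == 1%N.
    by have := cardsD1 v (vert e); rewrite card_vert ve add1n => -[<-].
  rewrite ew imset_f // !inE.
  by have := set11 w; rewrite -ew in_setD1 => /andP[].
rewrite card_imset; last exact: set1_inj.
have n0 : (0 < n)%N := leq_ltn_trans (leq0n v) (ltn_ord v).
by rewrite cardsC1 card_ord ltn_predL.
Qed.

Lemma card_star_support (T : {set 'I_(Nc n)}) v (D : {set 'I_n}) :
  (forall w, w \in D -> exists2 e, e \in T & w != v /\ vert e = [set v; w]) ->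
  (#|D| <= #|[set e in T | v \in vert e]|)%N.
Proof.
move=> DT; rewrite -(card_imset _ (@set1_inj _)).
apply: leq_trans (leq_imset_card (fun e => vert e :\ v) _).
apply/subset_leq_card/subsetP => _ /imsetP[w wD ->].
have [e eT [wv ew]] := DT w wD.
apply/imsetP; exists e; first by rewrite inE eT ew !inE eqxx.
by rewrite ew setU1K // inE eq_sym.
Qed.

(* If every point differs from at least two others then the support has at least n
   edges, by counting edge-vertex incidences. *)
Lemma Mset1_small_support (y : 'cV[CC]_(Nc n)) : Mset 1 y ->
  (#|[set e | y e 0 != 0]%R| < n)%N -> exists w c, y = c *: cut [set w].
Proof.
case=> q eq_y small; set T := [set e | _] in small.
have yE i j e : vert e = [set i; j] -> y e 0 = (q i 0 - q j 0) ^+ 2.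
  by move=> ei; rewrite eq_y -(entryE _ ei) entry_mmap big_ord1.
pose D v := [set w | q w 0 != q v 0].
have [v Dv] : exists v, (#|D v| <= 1)%N.
  apply/existsP; apply: contraLR small; rewrite negb_exists -leqNgt => /forallP D2.
  rewrite -(@leq_pmul2r 2) //.
  have -> : (#|T| * 2 = \sum_v #|[set e in T | v \in vert e]|)%N.
    rewrite -sum_nat_const -(eq_bigr _ (fun e _ => card_vert e)).
    under [RHS]eq_bigr => v _ do rewrite -sum1_card.
    under eq_bigr => e _ do rewrite -sum1_card.
    rewrite (exchange_big_dep xpredT) //=; apply: eq_bigr => v _.
    by apply: eq_bigl => e; rewrite [RHS]inE.
  apply: (@leq_trans (\sum_(v < n) 2)); first by rewrite sum_nat_const card_ord.
  apply: leq_sum => v _; apply: (@leq_trans #|D v|); first by rewrite ltnNge.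
  apply: card_star_support => w; rewrite inE => qwv.
  have wv : w != v by apply: contraNneq qwv => ->.
  have [e ew] : exists e, vert e = [set v; w] by apply: vert_ex; rewrite eq_sym.
  by exists e; rewrite // inE (yE _ _ _ ew) sqrf_eq0 subr_eq0 eq_sym.
have [D0|[w wD]] := set_0Vmem (D v).
  exists v, 0; rewrite scale0r; apply/colP => e.
  have [i [j [_ ei]]] := vert_pair e.
  have qv i' : q i' 0 = q v 0.
    by apply/eqP; have := in_set0 i'; rewrite -D0 inE => /negbFE.
  by rewrite (yE _ _ _ ei) !qv subrr expr0n mxE.
have Dw : D v = [set w].
  by apply/esym/eqP; rewrite eqEcard sub1set wD cards1.
have qv i : i != w -> q i 0 = q v 0.
  by move=> iw; apply/eqP; have := in_set1 i w; rewrite -Dw inE (negPf iw) => /negbFE.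
exists w, ((q w 0 - q v 0) ^+ 2); apply/colP => e; rewrite mxE cut1E.
have [i [j [ij ei]]] := vert_pair e.
rewrite (yE _ _ _ ei) ei !inE ![w == _]eq_sym.
have [iw|iw] := eqVneq i w; have [jw|jw] := eqVneq j w.
- by rewrite iw jw eqxx in ij.
- by rewrite iw (qv j) // mulr1.
- by rewrite jw (qv i) // -opprB sqrrN mulr1.
- by rewrite (qv i) // (qv j) // subrr expr0n mulr0.
Qed.

End Stars.

(** * Extracting relabeling, signs and scale from the monomial matrix *)

Theorem theorem5p2 (d n : nat) (hd : (1 <= d)%N) (hn : (d + 3 <= n)%N)
    (A : 'M[CC]_(Nc n)) (hA : lin_aut d A) :
  exists (c : CC) (S : 'M[CC]_(Nc n)) (s : 'S_n),
    [/\ c != 0, sign_diag S & A = c *: (S *m edge_perm_mx s)].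
Proof.
have [uA [LA _]] := hA.
have /fin_all_exists[pi piP] : forall e, exists e0,
    A e0 e != 0 /\ forall e1, e1 != e0 -> A e1 e = 0.
  by move=> e; have [e0 nz A0] := lin_aut_monomial e hd hn hA; exists e0.
have Apx e : A (pi e) e != 0 := (piP e).1.
have A0 e e1 : e1 != pi e -> A e1 e = 0 := (piP e).2 e1.
have colA (l : 'rV[CC]_(Nc n)) (M : 'M[CC]_(Nc n)) e :
    (forall e1, e1 != pi e -> M e1 e = 0) -> (l *m M) 0 e = l 0 (pi e) * M (pi e) e.
  by move=> M0; rewrite mxE (bigD1 (pi e)) //= big1 ?addr0 // => k /M0 ->; rewrite mulr0.
have pi_inj : injective pi.
  move=> e e' epi; apply/eqP/negP => /negP ne.
  have VA a a' : invmx A a (pi a') * A (pi a') a' = (a == a')%:R.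
    have := colA (row a (invmx A)) A a' (@A0 a').
    by rewrite -row_mul mulVmx // !mxE => <-.
  have /eqP := VA e' e; rewrite [e' == e]eq_sym (negPf ne) mulf_eq0 (negPf (Apx e)) orbF => /eqP V0.
  by have /eqP := VA e' e'; rewrite -epi V0 mul0r eqxx eq_sym oner_eq0.
(* As A is monomial, squaring coordinates turns the action of A into that of B. *)
pose B : 'M[CC]_(Nc n) := map_mx (fun z => z ^+ 2) A.
have B0 e e1 : e1 != pi e -> B e1 e = 0 by move=> ne; rewrite mxE A0 // expr0n.
have Bpi e : B (pi e) e != 0 by rewrite mxE sqrf_eq0.
have piV e1 : exists e, e1 = pi e.
  by exists (invF pi_inj e1); rewrite f_invF.
have BE y e : (B *m y) (pi e) 0 = B (pi e) e * y e 0.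
  rewrite mxE (bigD1 e) //= big1 ?addr0 // => k nk.
  by rewrite B0 ?mul0r // (inj_eq pi_inj) eq_sym.
have AE x e : (A *m x) (pi e) 0 = A (pi e) e * x e 0.
  rewrite mxE (bigD1 e) //= big1 ?addr0 // => k nk.
  by rewrite A0 ?mul0r // (inj_eq pi_inj) eq_sym.
have injB (l : 'rV_(Nc n)) : l *m B = 0 -> l = 0.
  move=> lB; apply/rowP => e1; have [e ->] := piV e1; rewrite mxE.
  have /rowP/(_ e)/eqP := lB; rewrite colA; last exact: B0.
  by rewrite [X in _ == X]mxE mulf_eq0 (negPf (Bpi e)) orbF => /eqP.
have MB y : Mset d y -> Mset d (B *m y).
  move=> /Lset_Mset[x /LA Lx <-].
  rewrite (_ : B *m _ = sqmap (A *m x)) //; apply/colP => e1; have [e ->] := piV e1.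
  by rewrite BE [RHS]mxE AE exprMn !mxE.
have M1B := Mset_descent1 hd hn injB MB.
have /fin_all_exists[sg sgP] : forall v, exists w, exists c, B *m cut [set v] = c *: cut [set w].
  move=> v; apply: Mset1_small_support; first exact/M1B/Mset_cut.
  apply: (@leq_ltn_trans #|pi @: [set e | v \in vert e]|).
    2: by rewrite card_imset ?card_star.
  apply/subset_leq_card/subsetP => e1.
  have [e ->] := piV e1; rewrite inE BE cut1E mem_imset // inE.
  by case: (v \in vert e); rewrite // mulr0 eqxx.
have {sgP}/fin_all_exists[c cP] := sgP.
have Bv v e : B (pi e) e * (v \in vert e)%:R = c v * (sg v \in vert (pi e))%:R.
  by have /colP/(_ (pi e)) := cP v; rewrite BE [RHS]mxE !cut1E.
have sg_in v e : v \in vert e -> sg v \in vert (pi e) /\ c v = B (pi e) e.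
  move=> ve; have := Bv v e; rewrite ve mulr1.
  case: (_ \in _) => [->|/eqP]; rewrite ?mulr1 //.
  by rewrite mulr0 (negPf (Bpi e)).
(* The edge joining [v] and [w] lies in both stars, and its entry of B equals both scalars. *)
have c_cst v w : c v = c w.
  have [->//|vw] := eqVneq v w; have [e ev] := vert_ex vw.
  have [_ ->] : sg v \in vert (pi e) /\ c v = B (pi e) e by apply: sg_in; rewrite ev !inE eqxx.
  by have [|_ ->] := sg_in w e; rewrite // ev !inE eqxx orbT.
have sg_inj : injective sg.
  move=> v w esg; apply/eqP/negP => /negP vw.
  (* The edge from [u] to [v] lies in the star of [v] but not of [w], so equal images would force a
     zero entry of B. *)
  have [u] : exists u, u \notin [set v; w].
    apply/existsP; rewrite -negb_forall; apply/negP => /forallP full.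
    have : (#|'I_n| <= #|[set v; w]|)%N by apply/subset_leq_card/subsetP.
    by rewrite card_ord cards2 vw; lia.
  rewrite !inE negb_or => /andP[uv uw]; have [e eu] := vert_ex uv.
  have [|sv cv] := sg_in v e; first by rewrite eu !inE eqxx orbT.
  have we : (w \in vert e) = false.
    by rewrite eu !inE [w == u]eq_sym (negPf uw) [w == v]eq_sym (negPf vw).
  have := Bv w e; rewrite we mulr0 -esg sv mulr1 (c_cst w v) cv => /esym/eqP.
  by rewrite (negPf (Bpi e)).
have vert_pi e : vert (pi e) = sg @: vert e.
  apply/esym/eqP; rewrite eqEcard (card_imset _ sg_inj) !card_vert leqnn andbT.
  by apply/subsetP => _ /imsetP[v /sg_in[sv _] ->].
have v0 : 'I_n by case: (n) hn => [|n' _]; [rewrite addn3 | exact: ord0].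
have [v1 v01] : exists v, v0 != v.
  apply/existsP; rewrite -negb_forall; apply/negP => /forallP full.
  have : (#|'I_n| <= #|[set v0]|)%N by apply/subset_leq_card/subsetP => v _; rewrite inE eq_sym.
  by rewrite card_ord cards1; lia.
have [e0 ev0] := vert_ex v01.
have BC e : B (pi e) e = c v0.
  have [i [j [_ ei]]] := vert_pair e; rewrite (c_cst v0 i).
  by have [|_ ->] := sg_in i e; rewrite // ei !inE eqxx.
have c0 : sqrtC (c v0) != 0 by rewrite sqrtC_eq0 -(BC e0).
(* Each row sum is the single nonzero entry of that row of A; its square is [c v0], so the quotient
   is a sign. *)
pose S : 'M[CC]_(Nc n) := diag_mx (\row_l ((\sum_e A l e) / sqrtC (c v0))).
have SE e : S (pi e) (pi e) = A (pi e) e / sqrtC (c v0).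
  rewrite !mxE eqxx mulr1n (bigD1 e) //= big1 ?addr0 // => k nk.
  by rewrite A0 // (inj_eq pi_inj) eq_sym.
exists (sqrtC (c v0)), S, (perm sg_inj); split=> //.
  split=> [|e1]; first exact: diag_mx_is_diag.
  have [e ->] := piV e1.
  have : S (pi e) (pi e) ^+ 2 == 1.
    by rewrite SE expr_div_n sqrtCK -(BC e) mxE divff // sqrf_eq0.
  by rewrite sqrf_eq1 => /orP[]/eqP ->; [left | right].
apply/matrixP => e1 e2; have [e ->] := piV e1.
have SM (M : 'M[CC]_(Nc n)) i j : (S *m M) i j = S i i * M i j.
  by rewrite mul_diag_mx !mxE eqxx mulr1n.
rewrite mxE SM SE mxE -!/(vert _).
have -> : perm sg_inj @: vert e2 = vert (pi e2).
  by rewrite vert_pi; apply: eq_imset => v; rewrite permE.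
rewrite (inj_eq (@vert_inj n)) (inj_eq pi_inj).
have [->|ne] := eqVneq e e2; first by rewrite mulr1 mulrCA divff // mulr1.
by rewrite !mulr0 A0 // (inj_eq pi_inj).
Qed.
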